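(* $(\mathcal{P}_{\mathcal{A}})^{inj}=\mathcal{P}_{\mathcal{K}}$; that is, the injective hull of the ideal of approximable homogeneous polynomials is the ideal of compact homogeneous polynomials.
   Context: All Banach spaces are over $\mathbb{K}=\mathbb{R}$ or $\mathbb{C}$. For Banach spaces $E,F$ and $m\in\mathbb{N}$, $\mathcal{P}(^mE;F)$ is the space of continuous $m$-homogeneous polynomials from $E$ to $F$ with the usual sup norm over the closed unit ball $B_E$. $\mathcal{P}_{\mathcal{F}}$ is the ideal of finite rank polynomials: $P\in\mathcal{P}(^mE;F)$ such that the range of $P$ spans a finite-dimensional subspace of $F$. $\mathcal{P}_{\mathcal{A}}=\overline{\mathcal{P}_{\mathcal{F}}}$ is the ideal of approximable polynomials: $\mathcal{P}_{\mathcal{A}}(^mE;F)$ is the closure of $\mathcal{P}_{\mathcal{F}}(^mE;F)$ in $\mathcal{P}(^mE;F)$ for the sup norm. $\mathcal{P}_{\mathcal{K}}$ is the ideal of compact polynomials: those $P\in\mathcal{P}(^mE;F)$ sending bounded sets to relatively compact sets. For a polynomial ideal $\mathcal{Q}$ (a class of continuous homogeneous polynomials whose components $\mathcal{Q}(^mE;F)$ are linear subspaces of $\mathcal{P}(^mE;F)$ containing the finite type polynomials $x\mapsto\sum_i\varphi_i(x)^my_i$ (finite sums, $\varphi_i\in E^*$, $y_i\in F$) and which is stable under left and right composition with bounded linear operators), the injective hull $\mathcal{Q}^{inj}$ is given by $$\mathcal{Q}^{inj}(^mE;F)=\{P\in\mathcal{P}(^mE;F): I_F\circ P\in\mathcal{Q}(^mE;\ell_\infty(B_{F^*}))\},$$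 where $I_F\colon F\to\ell_\infty(B_{F^*})$, $I_F(y)=(\varphi(y))_{\varphi\in B_{F^*}}$, $B_{F^*}$ is the closed unit ball of $F^*$ and $\ell_\infty(B_{F^*})$ is the space of bounded scalar functions on $B_{F^*}$ with the sup norm. *)

(* Defs.v *)
From HB Require Import structures.
From mathcomp Require Import all_boot all_order all_algebra.
From mathcomp Require Import complex.
From mathcomp Require Import all_classical all_reals all_analysis.

Set Implicit Arguments.
Unset Strict Implicit.
Unset Printing Implicit Defensive.

Import Order.TTheory GRing.Theory Num.Def Num.Theory.
Import numFieldNormedType.Exports.

Local Open Scope classical_set_scope.
Local Open Scope ring_scope.

Variant scalar_kind := RealScalars | ComplexScalars.

Definition scalar_field (R : realType) (k : scalar_kind) : numFieldType :=
  match k with RealScalars => R | ComplexScalars => R[i] end.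

Section Polynomials.
Variable K : numFieldType.

(* In a [normedModType K] the norm takes its values in [K]; for [K = R[i]] the
   order is partial, but it is the usual one on the real axis, so the supremum of a
   nonempty bounded set of norms is the usual one. *)
Definition sup_norm (T : Type) (V : normedModType K) (A : set T)
    (f : T -> V) : K :=
  supremum 0 [set `|f x| | x in A].

Definition unit_ball (E : normedModType K) : set E := [set x | `|x| <= 1].
Arguments unit_ball : clear implicits.

Definition multilinear (E F : lmodType K) (m : nat) (A : ('I_m -> E) -> F) :=
  forall (x : 'I_m -> E) (i : 'I_m),
    linear (fun u : E => A (fun j => if j == i then u else x j)).

Definition homogeneous_polynomial (E F : lmodType K) (m : nat) : set (E -> F) :=
  [set P | exists2 A : ('I_m -> E) -> F,
     multilinear A & forall x, P x = A (fun=> x)].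

Definition cont_polynomial (E F : normedModType K) (m : nat) : set (E -> F) :=
  [set P | homogeneous_polynomial m P /\ continuous P].

Definition linear_span (V : lmodType K) (A : set V) : set V :=
  [set v | exists (n : nat) (c : 'I_n -> K) (a : 'I_n -> V),
     (forall i, A (a i)) /\ v = \sum_(i < n) c i *: a i].

Definition finite_dimensional (V : lmodType K) (W : set V) :=
  exists (n : nat) (b : 'I_n -> V), W = linear_span (range b).

(* The ideal axioms are not part of the type: the formula for the injective hull
   makes sense for any class. *)
Definition polynomial_class :=
  forall E F : completeNormedModType K, nat -> set (E -> F).

Definition finite_rank : polynomial_class := fun E F m =>
  [set P | cont_polynomial m P /\ finite_dimensional (linear_span (range P))].

Definition approximable : polynomial_class := fun E F m =>
  [set P | cont_polynomial m P /\
     forall e : K, 0 < e ->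
       exists2 Q : E -> F, finite_rank m Q &
         sup_norm (unit_ball E) (P \- Q) < e].

Definition compact_polynomial : polynomial_class := fun E F m =>
  [set P | cont_polynomial m P /\
     forall B : set E, bounded_set B -> precompact (P @` B)].

Definition dual_ball (F : normedModType K) : Type :=
  {phi : F -> K^o |
    [/\ linear phi, continuous phi & sup_norm (unit_ball F) phi <= 1]}.

Definition bounded_pred (I : Type) : {pred I -> K^o} :=
  fun f => `[< bounded_fun f >].
Arguments bounded_pred : clear implicits.

Record linf (I : Type) := Linf {
  linf_fun :> I -> K^o;
  linf_boundedP : linf_fun \in bounded_pred I }.

End Polynomials.

Arguments unit_ball {K} E.
Arguments bounded_pred {K} I.
Arguments finite_rank {K} E F m _.
Arguments approximable {K} E F m _.
Arguments compact_polynomial {K} E F m _.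

Section BoundedFunctions.
Variables (K : numFieldType) (I : Type).

Lemma bounded_funE (f : I -> K^o) :
  bounded_fun f <-> exists M, forall i, `|f i| <= M.
Proof.
split=> [/pinfty_ex_gt0[M _ fM]|[M fM]]; first by exists M => i; exact: fM.
have [[i _]|noI] := pselect (exists i : I, True).
  have M0 : 0 <= M by rewrite (le_trans _ (fM i)).
  exists M; split; first exact: ger0_real.
  by move=> N MN j _ /=; rewrite (le_trans (fM j))// ltW.
by exists 0; split => // N _ i _; case: noI; exists i.
Qed.

Lemma bounded_predP (f : I -> K^o) :
  reflect (exists M, forall i, `|f i| <= M) (f \in bounded_pred I).
Proof. by apply: (iffP (asboolP _)) => /bounded_funE. Qed.

Lemma bounded_pred_submod_closed : @submod_closed K (I -> K^o) (bounded_pred I).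
Proof.
split=> [|a f g]; first by apply/bounded_predP; exists 0 => i; rewrite normr0.
move=> /bounded_predP[M fM] /bounded_predP[N gN]; apply/bounded_predP.
exists (`|a| * M + N) => i; rewrite (le_trans (ler_normD _ _))// lerD//.
by rewrite normrZ ler_wpM2l.
Qed.

HB.instance Definition _ := [isSub of linf K I for @linf_fun K I].
HB.instance Definition _ := [Choice of linf K I by <:].
HB.instance Definition _ :=
  GRing.isSubmodClosed.Build K (I -> K^o) (bounded_pred I)
    bounded_pred_submod_closed.
HB.instance Definition _ := [SubChoice_isSubLmodule of linf K I by <:].

Lemma linfD (f g : linf K I) i : (f + g) i = f i + g i. Proof. by []. Qed.
Lemma linfZ (a : K) (f : linf K I) i : (a *: f) i = a *: f i. Proof. by []. Qed.
Lemma linfB (f g : linf K I) i : (f - g) i = f i - g i. Proof. by []. Qed.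

Lemma linf_bounded (f : linf K I) : exists M, forall i, `|f i| <= M.
Proof. exact/bounded_predP/linf_boundedP. Qed.

End BoundedFunctions.

Section Scalars.
Variables (R : realType) (k : scalar_kind).
Local Notation K := (scalar_field R k).

Lemma scalar_supremum (A : set K) : A !=set0 ->
  (forall x, A x -> 0 <= x) -> (exists M, ubound A M) ->
  supremums A (supremum 0 A).
Proof.
move=> A0 Age0 [M AM].
suff : exists s, supremums A s.
  move=> [s sA]; rewrite /supremum; case: ifPn => [/eqP AE|_].
    by move: A0; rewrite AE => -[].
  by apply: xgetPex; exists s.
case: k A A0 Age0 M AM => /= A [x0 Ax0] Age0 M AM.
  have hA : has_sup A by split; [exists x0|exists M].
  exists (sup A); split; first exact: sup_upper_bound.
  by move=> y Ay; apply: ge_sup => //; exists x0.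
pose B := [set complex.Re x | x in A].
have AE x : A x -> x = (complex.Re x)%:C%C.
  by move=> /Age0; case: x => a b; rewrite lecE/= => /andP[/eqP->].
have hB : has_sup B.
  split; first by exists (complex.Re x0), x0.
  by exists (complex.Re M) => _ [x Ax <-]; have := AM _ Ax; rewrite lecE => /andP[].
exists (sup B)%:C%C; split=> [x Ax|y Ay].
  rewrite {1}(AE _ Ax) lecE/= eqxx/=.
  by apply: sup_upper_bound => //; exists x.
have := Ay _ Ax0; rewrite {1}(AE _ Ax0) lecE/= => /andP[/eqP Imy _].
rewrite lecE/= Imy eqxx/=; apply: ge_sup; first by case: hB.
by move=> _ [x Ax <-]; have := Ay _ Ax; rewrite lecE => /andP[].
Qed.

Lemma sup_normP (T : Type) (V : normedModType K) (A : set T) (f : T -> V) :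
  A !=set0 -> (exists M, forall x, A x -> `|f x| <= M) ->
  (forall x, A x -> `|f x| <= sup_norm A f) /\
  (forall M, (forall x, A x -> `|f x| <= M) -> sup_norm A f <= M).
Proof.
move=> [x0 Ax0] [M AM].
have [] : supremums [set `|f x| | x in A] (sup_norm A f).
  apply: scalar_supremum; first by exists `|f x0|, x0.
    by move=> _ [x _ <-].
  by exists M => _ [x /AM ? <-].
move=> ub lub; split=> [x Ax|N AN]; first by apply: ub; exists x.
by apply: lub => _ [x /AN ? <-].
Qed.

Lemma scalar_complete (F : set_system K^o) :
  ProperFilter F -> cauchy F -> cvg F.
Proof.
case: k F => /= F FF; first exact: (@R_complete R).
have part (p : R[i] -> R) : (forall z w, `|p z - p w|%:C%C <= `|z - w|) ->
    cauchy F -> cvg (p @ F).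
  move=> pB /cauchyP Fc; apply: R_complete; apply/cauchyP => e e0.
  have [|z Fz] := Fc e%:C%C; first by rewrite ltcR.
  exists (p z); change (F (p @^-1` ball (p z) e)).
  apply: filterS Fz => w; rewrite /preimage/= -!ball_normE/= => zw.
  by rewrite -ltcR; exact: le_lt_trans (pB z w) zw.
move=> Fc.
have /cvg_ex[/= a Fa] : cvg (@complex.Re R @ F).
  apply: part => // -[a b] [c d]; rewrite normc_def lecR -sqrtr_sqr.
  by rewrite ler_wsqrtr// lerDl sqr_ge0.
have /cvg_ex[/= b Fb] : cvg (@complex.Im R @ F).
  apply: part => // -[a' b] [c d]; rewrite normc_def lecR -sqrtr_sqr.
  by rewrite ler_wsqrtr// lerDr sqr_ge0.
have tri (z : R[i]) : `|(a +i* b)%C - z| <=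
    (`|a - complex.Re z| + `|b - complex.Im z|)%:C%C.
  case: z => c d; rewrite normc_def lecR /=.
  rewrite -[leRHS]ger0_norm ?addr_ge0// -sqrtr_sqr ler_wsqrtr//.
  rewrite [(`|_| + _) ^+ 2]sqrrD !real_normK ?num_real// lerD2r lerDl.
  by rewrite mulrn_wge0// mulr_ge0.
apply/cvg_ex; exists (a +i* b)%C; apply/cvgrPdist_lt => -[r s].
rewrite ltcE/= => /andP[/eqP-> r0]; have r20 : 0 < r / 2 by rewrite divr_gt0.
near=> z; rewrite (le_lt_trans (tri z))// ltcR (splitr r) ltrD//.
  by near: z; move/cvgrPdist_lt : Fa; exact.
by near: z; move/cvgrPdist_lt : Fb; exact.
Unshelve. all: by end_near. Qed.

Section Linf.
Variable I : Type.

Definition linf_norm (f : linf K I) : K := sup_norm setT f.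

Lemma linf_norm_ge (f : linf K I) i : `|f i| <= linf_norm f.
Proof.
have [M fM] := linf_bounded f.
have [||+ _] := @sup_normP I K^o setT f; [by exists i|by exists M|exact].
Qed.

Lemma linf_norm_ge0 (f : linf K I) : 0 <= linf_norm f.
Proof.
have [[i _]|noI] := pselect (exists i : I, True).
  by rewrite (le_trans _ (linf_norm_ge f i)).
rewrite /linf_norm /sup_norm (_ : [set _ | _ in _] = set0) ?supremum0//.
by apply/seteqP; split=> // x [j]; case: noI; exists j.
Qed.

Lemma linf_norm_le (f : linf K I) M :
  0 <= M -> (forall i, `|f i| <= M) -> linf_norm f <= M.
Proof.
move=> M0 fM; have [[i _]|noI] := pselect (exists i : I, True).
  by have [||_] := @sup_normP I K^o setT f; [exists i|exists M|apply].
rewrite /linf_norm /sup_norm (_ : [set _ | _ in _] = set0) ?supremum0//.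
by apply/seteqP; split=> // x [j]; case: noI; exists j.
Qed.

Lemma linf_normD (f g : linf K I) :
  linf_norm (f + g) <= linf_norm f + linf_norm g.
Proof.
apply: linf_norm_le => [|i]; first by rewrite addr_ge0 ?linf_norm_ge0.
by rewrite linfD (le_trans (ler_normD _ _))// lerD ?linf_norm_ge.
Qed.

Lemma linf_normZ (a : K) (f : linf K I) :
  linf_norm (a *: f) = `|a| * linf_norm f.
Proof.
have le b g : linf_norm (b *: g) <= `|b| * linf_norm g.
  apply: linf_norm_le => [|i]; first by rewrite mulr_ge0 ?linf_norm_ge0.
  by rewrite linfZ normrZ ler_wpM2l ?linf_norm_ge.
have [->|a0] := eqVneq a 0.
  apply/le_anti; rewrite le/= normr0 mul0r; exact: linf_norm_ge0.
apply/le_anti; rewrite le/= -ler_pdivlMl ?normr_gt0// -normfV.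
by rewrite (le_trans _ (le _ _))// scalerA mulVf// scale1r.
Qed.

Lemma linf_norm0_eq0 (f : linf K I) : linf_norm f = 0 -> f = 0.
Proof.
move=> f0; apply/val_inj/funext => i /=; apply/eqP.
by rewrite -normr_le0 -f0 linf_norm_ge.
Qed.

HB.instance Definition _ := Lmodule_isNormed.Build K (linf K I)
  linf_normD linf_normZ linf_norm0_eq0.

Lemma linf_normE (f : linf K I) : `|f| = sup_norm setT f. Proof. by []. Qed.

Lemma linf_complete (F : set_system (linf K I)) :
  ProperFilter F -> cauchy F -> cvg F.
Proof.
move=> FF /cauchy_ballP Fc.
have Fi i : cvg ((fun f : linf K I => f i : K^o) @ F).
  apply: scalar_complete; apply/cauchyP => e e0.
  have [f Ff] := (cauchyP F).1 ((cauchy_ballP F).1 Fc) _ e0.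
  exists (f i); change (F ((fun g : linf K I => g i : K^o) @^-1` ball (f i : K^o) e)).
  apply: filterS Ff => g; rewrite /preimage/= -!ball_normE/= => fg.
  exact: le_lt_trans (linf_norm_ge (f - g) i) fg.
pose l i : K^o := lim ((fun f : linf K I => f i : K^o) @ F).
have Fl (e : K) : 0 < e ->
    \forall f \near F, forall i, `|(f : linf K I) i - l i| <= e.
  move=> e0; apply: filterS (nearP_dep (Fc _ e0)) => f fF i.
  apply/ler_addgt0Pr => d d0.
  near F => g; rewrite (le_trans (ler_distD (g i) _ _))// lerD//.
    apply: le_trans (linf_norm_ge (f - g) i) _; apply: ltW.
    suff : ball f e g by rewrite -ball_normE.
    by near: g.
  by near: g; move/cvgrPdistC_le : (Fi i : _ --> l i); exact.
have lb : l \in bounded_pred I.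
  apply/bounded_predP; near F => f.
  exists (linf_norm f + 1) => i; rewrite -[l i](subrK (f i)) addrC.
  rewrite (le_trans (ler_normD _ _))// lerD ?linf_norm_ge// distrC.
  by move: i; near: f; exact: Fl.
apply/cvg_ex; exists (Linf lb); apply/cvgrPdist_le => e e0.
near=> f; rewrite distrC linf_normE; apply: linf_norm_le => [|i]; first exact: ltW.
by rewrite linfB /=; move: i; near: f; exact: Fl.
Unshelve. all: by end_near. Qed.

HB.instance Definition _ := Uniform_isComplete.Build (linf K I) linf_complete.

End Linf.

Lemma dual_ball_le (F : normedModType K) (phi : dual_ball F) (y : F) :
  `|sval phi y| <= `|y|.
Proof.
case: phi => phi [lphi cphi phi1] /=.
pose f : {linear F -> K^o} := HB.pack phi (GRing.isLinear.Build _ _ _ _ phi lphi).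
have [-> |y0] := eqVneq y 0.
  by rewrite (linear0 f : phi 0 = 0) !normr0.
have fbnd : bounded_near f (nbhs (0 : F)) by apply/linear_bounded_continuous.
have [r r0 fr] := pinfty_ex_gt0 ((linear_boundedP f).1 fbnd).
have [||+ _] := @sup_normP F K^o (unit_ball F) phi.
- by exists 0; rewrite /unit_ball/= normr0.
- exists r => x; rewrite /unit_ball/= => x1.
  by rewrite (le_trans (fr x))// ler_piMr// ltW.
move=> /(_ (`|y|^-1 *: y)); rewrite /unit_ball/= normfZV// => /(_ (lexx _)).
move=> /le_trans/(_ phi1); rewrite (linearZ_LR f _ _ : phi _ = _) normrZ normfV normr_id.
by rewrite ler_pdivrMl ?normr_gt0// mulr1.
Qed.

Lemma canonical_map_bounded (F : normedModType K) (y : F) :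
  (fun phi : dual_ball F => sval phi y) \in bounded_pred (dual_ball F).
Proof. by apply/bounded_predP; exists `|y| => phi; exact: dual_ball_le. Qed.

Definition canonical_map (F : normedModType K) (y : F) : linf K (dual_ball F) :=
  Linf (canonical_map_bounded y).

Definition injective_hull (Q : polynomial_class K) : polynomial_class K :=
  fun E F m => [set P | cont_polynomial m P /\
    Q E (linf K (dual_ball F)) m (@canonical_map F \o P)].

End Scalars.
Arguments injective_hull {R k} Q E F m _.

(* Main.v *)
(* If P is compact, colour the unit ball of E with finitely many colours so that P
   varies little on each colour class, pick one value y_t per colour, and colour the
   dual ball of F according to the approximate values of (phi(y_t))_t. Replacing each
   phi by a fixed representative of its class is a finite rank contraction S of
   l_oo(B_{F^*}) such that S o I_F o P is uniformly close to I_F o P on the unit ball.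
   Conversely, a finite rank polynomial into l_oo is bounded on the unit ball, and its
   values are recovered from finitely many coordinates, so its image is totally bounded;
   hence so is that of a uniform limit. By Hahn-Banach I_F is bounded below, which
   transfers total boundedness from I_F o P to P. *)
Require Import Defs.
From HB Require Import structures.
From mathcomp Require Import all_boot all_order all_algebra.
From mathcomp Require Import finmap complex ring lra.
From mathcomp Require Import all_classical all_reals all_analysis.

Set Implicit Arguments.
Unset Strict Implicit.
Unset Printing Implicit Defensive.

Import Order.TTheory GRing.Theory Num.Def Num.Theory.
Import numFieldNormedType.Exports.

Local Open Scope classical_set_scope.
Local Open Scope ring_scope.

(** * Total boundedness *)

Section TotallyBounded.
Variable K : numFieldType.

(* Total boundedness of [f @` A], phrased as finite colourings of [A] whose colour
   classes have small images, so that no centres have to be chosen. *)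
Definition totally_bounded_on (X : Type) (V : normedModType K) (A : set X)
    (f : X -> V) :=
  forall e : K, 0 < e -> exists (T : finType) (c : X -> T),
    forall x y, A x -> A y -> c x = c y -> `|f x - f y| <= e.

Lemma ler_dist3 (V : normedModType K) (x y z w : V) :
  `|x - w| <= `|x - y| + `|y - z| + `|z - w|.
Proof.
by rewrite (le_trans (ler_distD z _ _))// lerD2r ler_distD.
Qed.

Lemma third_split (e : K) : e = e / 3 + e / 3 + e / 3.
Proof. by field. Qed.

Lemma totally_bounded_on_approx (X : Type) (V : normedModType K) (A : set X)
    (f : X -> V) :
  (forall e : K, 0 < e -> exists2 g : X -> V,
    totally_bounded_on A g & forall x, A x -> `|f x - g x| <= e) ->
  totally_bounded_on A f.
Proof.
move=> H e e0; have e30 : 0 < e / 3 by rewrite divr_gt0.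
have [g tg fg] := H _ e30; have [T [c gc]] := tg _ e30.
exists T, c => x y Ax Ay cxy; rewrite (third_split e).
by rewrite (le_trans (ler_dist3 _ (g x) (g y) _))// !lerD ?fg ?gc// distrC fg.
Qed.

(** Finitely many balls of radius [e / 2] cover the compact closure; a point is coloured by the
    first ball that contains its image. *)
Lemma precompact_totally_bounded (X : Type) (V : normedModType K) (A : set X)
    (f : X -> V) :
  precompact (f @` A) -> totally_bounded_on A f.
Proof.
rewrite precompactE compact_cover => cA e e0.
have e20 : 0 < e / 2 by rewrite divr_gt0.
have [||D _ AD] := cA V setT (fun y => ball y (e / 2)).
- by move=> y _; exact: ball_open.
- by move=> y _; exists y => //; exact: ballxx.
pose i x := find (fun y => `[< ball y (e / 2) (f x) >]) D.
(* The extra colour [size D] is what [find] returns when no ball contains [f x], which can happen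
   outside [A]. *)
exists 'I_(size D).+1, (fun x => inord (i x)) => x y Ax Ay.
move=> /(congr1 val); rewrite /= !inordK ?ltnS ?find_size// => ixy.
have hasD z : A z -> has (fun y => `[< ball y (e / 2) (f z) >]) D.
  move=> Az; have [|w wD wz] := AD (f z); first by apply: subset_closure; exists z.
  by apply/hasP; exists w => //; apply/asboolP.
have := nth_find 0 (hasD _ Ay); have := nth_find 0 (hasD _ Ax).
rewrite -/(i x) -/(i y) ixy -!ball_normE => /asboolP/= h1 /asboolP/= h2.
rewrite (le_trans (ler_distD (nth 0 D (i y)) _ _))// (splitr e) lerD ?ltW//.
by rewrite distrC.
Qed.

(** Otherwise the ultrafilter would contain the complements of all colour classes, hence their
    finite intersection, which is empty. *)
Lemma ultra_color (T : finType) (X : Type) (c : X -> T) (F : set_system X) :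
  UltraFilter F -> exists t, F [set x | c x = t].
Proof.
move=> FU; apply: contrapT => noF.
have Fn t : F (~` [set x | c x = t]).
  have [Ft|//] := in_ultra_setVsetC [set x | c x = t] FU.
  by case: noF; exists t.
have /filter_ex[x /(_ (c x))] : F [set x | forall t, c x <> t].
  exact: filter_forall.
exact.
Qed.

Lemma totally_bounded_closure (X : Type) (V : normedModType K) (A : set X)
    (f : X -> V) :
  totally_bounded_on A f -> totally_bounded_on (closure (f @` A)) (@id V).
Proof.
move=> tA e e0; have e30 : 0 < e / 3 by rewrite divr_gt0.
have [A0|/set0P[x0 Ax0]] := eqVneq A set0.
  by exists unit, (fun=> tt) => x y; rewrite A0 image_set0 closure0.
have [T [c cA]] := tA _ e30.
(* A point of the closure inherits the colour of a nearby image point. With the implication under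
   the quantifier the choice is total; [x0] is the default off the closure. *)
have near_pt z : exists x, closure (f @` A) z -> A x /\ `|z - f x| < e / 3.
  have [cz|ncz] := pselect (closure (f @` A) z); last by exists x0.
  have [_ [[x Ax <-]]] := cz _ (nbhsx_ballx z _ e30).
  by rewrite -ball_normE /= => zx; exists x.
pose g z := sval (cid (near_pt z)).
exists T, (c \o g) => z w Cz Cw czw.
have [Az zg] := svalP (cid (near_pt z)) Cz.
have [Aw wg] := svalP (cid (near_pt w)) Cw.
rewrite (third_split e) (le_trans (ler_dist3 _ (f (g z)) (f (g w)) _))//.
by rewrite !lerD ?cA// ?ltW// distrC.
Qed.

(** An ultrafilter on the closure contains one colour class for every [e], so it is Cauchy and
    converges by completeness. *)
Lemma totally_bounded_precompact (X : Type) (V : completeNormedModType K)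
    (A : set X) (f : X -> V) :
  totally_bounded_on A f -> precompact (f @` A).
Proof.
move=> /totally_bounded_closure tA; rewrite precompactE compact_ultra => F FU FA.
have FF : ProperFilter F by exact: ultra_proper.
have Fc : cauchy F.
  apply/cauchy_exP => e e0.
  (* Halving turns the non-strict bound on a colour class into membership in an open ball of radius
     [e]. *)
  have [|T [c cA]] := tA (e / 2); first by rewrite divr_gt0.
  have [t Ft] := ultra_color c FU.
  have FtA : F ([set x | c x = t] `&` closure (f @` A)) by exact: filterI.
  have [z [zt zA]] := filter_ex FtA.
  exists z; apply: filterS FtA => w [wt wA].
  rewrite -ball_normE/= (le_lt_trans (cA _ _ zA wA (etrans zt (esym wt))))//.
  by rewrite ltr_pdivrMr// ltr_pMr// ltr1n.
have /cvg_ex[/= p Fp] : cvg F by exact: cauchy_cvg.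
exists p; split => //; apply: closed_closure => B pB.
have FAB : F (closure (f @` A) `&` B) by apply: filterI => //; exact: Fp.
exact: filter_ex FAB.
Qed.

Lemma totally_bounded_ffun (I : finType) (X : Type) (V : normedModType K)
    (A : set X) (f : I -> X -> V) :
  (forall i, totally_bounded_on A (f i)) ->
  forall e : K, 0 < e -> exists (T : finType) (c : X -> T),
    forall x y, A x -> A y -> c x = c y -> forall i, `|f i x - f i y| <= e.
Proof.
move=> tf e e0.
pose T i := projT1 (cid (tf i e e0)).
have cP i : exists c : X -> T i,
    forall x y, A x -> A y -> c x = c y -> `|f i x - f i y| <= e.
  exact: projT2 (cid (tf i e e0)).
pose c i := sval (cid (cP i)).
exists {dffun forall i, T i}, (fun x => [ffun i => c i x]) => x y Ax Ay cxy i.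
apply: (svalP (cid (cP i))) => //.
by have := congr1 (fun g : {dffun forall i, T i} => g i) cxy; rewrite !ffunE.
Qed.

End TotallyBounded.

(** * Linear spans and homogeneous polynomials *)

Section LinearSpan.
Variables (K : numFieldType) (V : lmodType K).

Definition linear_subspace (W : set V) :=
  W 0 /\ forall a x y, W x -> W y -> W (a *: x + y).

Lemma linear_subspace_sum (W : set V) (I : Type) (s : seq I) (c : I -> K)
    (a : I -> V) :
  linear_subspace W -> (forall i, W (a i)) -> W (\sum_(i <- s) c i *: a i).
Proof.
move=> [W0 WD] Wa; elim: s => [|i s IH]; first by rewrite big_nil.
by rewrite big_cons; exact: WD.
Qed.

Lemma linear_span_min (A W : set V) :
  linear_subspace W -> A `<=` W -> linear_span A `<=` W.
Proof.
move=> subW AW _ [n [c [a [Aa ->]]]].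
by apply: linear_subspace_sum => // i; exact: AW.
Qed.

Lemma linear_span_subspace (A : set V) : linear_subspace (linear_span A).
Proof.
split=> [|t _ _ [n [c [a [Aa ->]]]] [p [d [b [Ab ->]]]]].
  by exists 0, (fun=> 0), (fun=> 0); split=> [[]//|]; rewrite big_ord0.
pose glue T (f : 'I_n -> T) (g : 'I_p -> T) (i : 'I_(n + p)) :=
  match fintype.split i with inl j => f j | inr j => g j end.
exists (n + p), (glue K (fun j => t * c j) d), (glue V a b); rewrite /glue; split.
  by move=> i; case: fintype.split.
rewrite big_split_ord /= scaler_sumr; congr (_ + _); apply: eq_bigr => i _.
  by rewrite (unsplitK (inl i)) scalerA.
by rewrite (unsplitK (inr i)).
Qed.

Lemma sub_linear_span (A : set V) : A `<=` linear_span A.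
Proof.
move=> x Ax; exists 1, (fun=> 1), (fun=> x); split=> //.
by rewrite big_ord1 scale1r.
Qed.

Lemma linear_span_range (n : nat) (b : 'I_n -> V) :
  linear_span (range b) = range (fun c : 'rV[K]_n => \sum_i c 0 i *: b i).
Proof.
apply/seteqP; split=> [|_ [c _ <-]]; last by exists n, (c 0), b; split.
apply: linear_span_min => [|_ [i _ <-]].
  split=> [|t _ _ [c _ <-] [d _ <-]].
    by exists 0 => //; rewrite big1// => i _; rewrite mxE scale0r.
  exists (t *: c + d) => //; rewrite scaler_sumr -big_split/=.
  by apply: eq_bigr => i _; rewrite !mxE scalerDl scalerA.
exists (delta_mx 0 i) => //; rewrite (bigD1 i)//= big1 ?addr0.
  by rewrite mxE !eqxx scale1r.
by move=> j ji; rewrite mxE (negbTE ji) andbF scale0r.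
Qed.

(* The coefficient vectors of the elements of [W] form a subspace of the row vectors;
   a matrix of maximal rank with rows in it spans it. *)
Lemma subspace_finite_dimensional (n : nat) (b : 'I_n -> V) (W : set V) :
  linear_subspace W -> W `<=` linear_span (range b) -> finite_dimensional W.
Proof.
move=> subW; rewrite linear_span_range => Wb.
pose L (c : 'rV[K]_n) := \sum_i c 0 i *: b i.
have LZD t c d : L (t *: c + d) = t *: L c + L d.
  rewrite /L scaler_sumr -big_split/=; apply: eq_bigr => i _.
  by rewrite !mxE scalerDl scalerA.
have L0 : L 0 = 0 by rewrite /L big1// => i _; rewrite mxE scale0r.
pose Q p (A : 'M[K]_(p, n)) := forall i, W (L (row i A)).
have LA p (A : 'M[K]_(p, n)) v : L (v *m A) = \sum_i v 0 i *: L (row i A).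
  rewrite mulmx_sum_row.
  apply: (big_ind2 (fun x y => L x = y)) => // [x1 _ y1 _ <- <-|i _].
    by rewrite -[x1 in LHS]scale1r LZD scale1r.
  by rewrite -[_ *: row i A]addr0 LZD L0 addr0.
have QW p (A : 'M[K]_(p, n)) v : Q _ A -> W (L (v *m A)).
  by move=> QA; rewrite LA; exact: linear_subspace_sum.
pose has_rank r := `[< exists2 A : 'M[K]_n, Q _ A & \rank A = r >].
have ex0 : exists r, has_rank r.
  exists 0; apply/asboolP; exists 0; rewrite ?mxrank0//.
  by move=> i; rewrite row0 L0; case: subW.
have ubr r : has_rank r -> (r <= n)%N.
  by move=> /asboolP[A _ <-]; exact: rank_leq_row.
case: (ex_maxnP ex0 ubr) => r /asboolP[A QA rA] maxr.
exists n, (fun i => L (row i A)); rewrite linear_span_range; apply/seteqP; split.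
  move=> x Wx; have [v _ vx] := Wb _ Wx.
  (* Adjoining [v] to [A] keeps all rows admissible, so by maximality the rank does not grow and [v]
     is in the row space of [A]. *)
  suff /submxP[u vuA] : (v <= A)%MS.
    by exists u => //; rewrite -vx -/(L v) vuA LA.
  have QAv : Q _ (A + v)%MS.
    move=> i; have /sub_addsmxP[[u w] /= ->] := row_sub i (A + v)%MS.
    rewrite -[u *m A]scale1r LZD scale1r -[L (u *m A)]scale1r.
    case: subW => _; apply; first exact: QW.
    by apply: QW => j; rewrite row_id /L vx.
  have /maxr : has_rank (\rank (A + v)%MS) by apply/asboolP; exists (A + v)%MS.
  rewrite -rA (geq_leqif (mxrank_leqif_sup (addsmxSl A v))).
  by rewrite addsmx_sub => /andP[].
move=> _ [c _ <-]; rewrite -LA; exact: QW.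
Qed.
End LinearSpan.

Section Polynomials.
Variable K : numFieldType.

Lemma homogeneous_polynomialZ (E F : lmodType K) (m : nat) (P : E -> F) :
  homogeneous_polynomial m P -> forall a x, P (a *: x) = a ^+ m *: P x.
Proof.
move=> [A Alin PE] a x; rewrite !PE.
(* The scalar is pulled out one argument at a time; [X n] has its first [n] arguments scaled. *)
pose X n (j : 'I_m) := if (j < n)%N then a *: x else x.
suff XE n : (n <= m)%N -> A (X n) = a ^+ n *: A (fun=> x).
  by rewrite -XE//; congr A; apply/funext => j; rewrite /X ltn_ord.
elim: n => [|n IH] nm; first by rewrite scale1r; congr A; exact/funext.
pose g u := A (fun j => if j == Ordinal nm then u else X n j).
have glin : linear g by exact: Alin.
have -> : A (X n.+1) = g (a *: x).
  congr A; apply/funext => j; rewrite /X ltnS leq_eqVlt -val_eqE /=.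
  by case: eqP.
have -> : g (a *: x) = a *: g x.
  exact: (scalable_linear glin).
rewrite exprS -[RHS]scalerA -(IH (ltnW nm)); congr (_ *: A _); apply/funext => j.
by rewrite /X -val_eqE /=; case: eqP => // ->; rewrite ltnn.
Qed.

(** Continuity at 0 bounds [P] on a small ball, and homogeneity carries the bound to every
    radius. *)
Lemma cont_polynomial_bounded (E F : normedModType K) (m : nat) (P : E -> F) :
  cont_polynomial m P -> forall r, exists M, forall x, `|x| <= r -> `|P x| <= M.
Proof.
move=> [hP cP] r.
have /cvgrPdist_lt/(_ 1 ltr01)/nbhs_norm0P[d /= d0 dP] := cP 0.
(* The order of [K] may be partial, so the negation of [0 < r] does not give [r <= 0]. But [0 <= r]
   as soon as some [x] has norm at most [r], and then [r = 0] and [x = 0]. *)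
have [r0|r0] := boolP (0 < r); last first.
  exists `|P 0| => x xr.
  have := le_trans (normr_ge0 x) xr; rewrite le_eqVlt (negbTE r0) orbF => /eqP rE.
  by move: xr; rewrite -rE normr_le0 => /eqP->.
pose t := 2 * r / d; have t0 : 0 < t by rewrite divr_gt0// mulr_gt0.
exists (`|t ^+ m| * (`|P 0| + 1)) => x xr.
rewrite -[x](scalerKV (lt0r_neq0 t0)) (homogeneous_polynomialZ hP) normrZ ler_wpM2l//.
have /dP : `|t^-1 *: x| < d.
  rewrite normrZ normfV (gtr0_norm t0) ltr_pdivrMl// /t divfK ?gt_eqF//.
  by rewrite (le_lt_trans xr)// mulr_natl mulr2n ltrDl.
rewrite /= => /ltW yP; rewrite -[P _](subrK (P 0)) addrC.
by rewrite (le_trans (ler_normD _ _))// lerD// distrC.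
Qed.

Lemma cont_polynomial_comp (E F G : normedModType K) (m : nat) (P : E -> F)
    (T : F -> G) :
  linear T -> continuous T -> cont_polynomial m P -> cont_polynomial m (T \o P).
Proof.
move=> Tlin cT [[A Alin PE] cP]; split; last first.
  by move=> x; apply: continuous_comp; [exact: cP|exact: cT].
exists (T \o A) => [x i a u v|x] /=; last by rewrite PE.
by rewrite Alin Tlin.
Qed.

End Polynomials.

(** * The Hahn-Banach theorem *)

Section HahnBanach.
Variables (R : realType) (V : lmodType R) (p : V -> R).
Hypothesis pD : forall x y, p (x + y) <= p x + p y.
Hypothesis pZ : forall a x, 0 <= a -> p (a *: x) = a * p x.

(* Partial linear functionals are represented by their graphs. *)
Let partial_functional (G : set (V * R)) :=
  linear_subspace (G : set (V * R^o)%type) /\ forall z, G z -> z.2 <= p z.1.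

Let p0 : p 0 = 0.
Proof. by rewrite -(scale0r 0) pZ// mul0r. Qed.

Let one_step_extension (G : set (V * R)) (v : V) :
  partial_functional G ->
  exists2 G', partial_functional G' & G `<=` G' /\ exists c, G' (v, c).
Proof.
move=> [[G0 GZD] Gp].
have GD w s w' s' : G (w, s) -> G (w', s') -> G (w + w', s + s').
  by move=> Gw Gw'; have := GZD 1 _ _ Gw Gw'; rewrite !scale1r.
have GZ a w s : G (w, s) -> G (a *: w, a * s).
  by move=> Gw; have := GZD a _ _ Gw G0; rewrite addr0.
(* A value at [v] must lie above all the left sides and below all the right sides; subadditivity at
   [(z - v) + (w + v)] makes this possible, and [c] is the supremum of the left sides. *)
have sandwich z w : G z -> G w -> z.2 - p (z.1 - v) <= p (w.1 + v) - w.2.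
  case: z w => [z s] [w t] Gz Gw /=; have := Gp _ (GD _ _ _ _ Gz Gw).
  have := pD (z - v) (w + v); rewrite addrACA addNr addr0 /=; lra.
pose S := [set z.2 - p (z.1 - v) | z in G].
have S0 : S !=set0 by exists (0 - p (0 - v)), 0.
have Sub w : G w -> ubound S (p (w.1 + v) - w.2).
  by move=> Gw _ [z Gz <-]; exact: sandwich.
pose c := sup S.
have c_ge z : G z -> z.2 - p (z.1 - v) <= c.
  by move=> Gz; apply: ub_le_sup; [exists (p (0 + v) - 0); exact: (Sub 0)|exists z].
have c_le w : G w -> c <= p (w.1 + v) - w.2.
  by move=> Gw; apply: ge_sup => //; exact: Sub.
exists [set z : V * R | exists w s t, G (w, s) /\ z = (w + t *: v, s + t * c)].
  split; first split.
  - by exists 0, 0, 0; rewrite scale0r mul0r !addr0.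
  - move=> a _ _ [w [s [t [Gw ->]]]] [w' [s' [t' [Gw' ->]]]].
    exists (a *: w + w'), (a * s + s'), (a * t + t'); split.
      by apply: GD => //; exact: GZ.
    congr pair => /=.
      by rewrite scalerDr scalerDl scalerA addrACA.
    by rewrite /GRing.scale/=; ring.
  - move=> _ [w [s [t [Gw ->]]]] /=.
    (* Dividing by the absolute value of [t] reduces to coefficient 1 or -1: [c_le] settles [t > 0],
       and [c_ge] settles [t < 0]. *)
    have [t0|t0|->] := ltgtP t 0; last first.
    + by rewrite scale0r mul0r !addr0; exact: (Gp _ Gw).
    + have := c_le _ (GZ t^-1 _ _ Gw); rewrite /= => cle.
      have -> : w + t *: v = t *: (t^-1 *: w + v).
        by rewrite scalerDr scalerA divff ?gt_eqF// scale1r.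
      rewrite (pZ _ (ltW t0)); have := ler_wpM2l (ltW t0) cle.
      by rewrite mulrBr mulrA divff ?gt_eqF// mul1r; lra.
    + have u0 : 0 < - t by rewrite oppr_gt0.
      have := c_ge _ (GZ (- t)^-1 _ _ Gw); rewrite /= => cge.
      have -> : w + t *: v = (- t) *: ((- t)^-1 *: w - v).
        by rewrite scalerBr scalerA divff ?gt_eqF// scale1r scaleNr opprK.
      rewrite (pZ _ (ltW u0)); have := ler_wpM2l (ltW u0) cge.
      by rewrite mulrBr mulrA divff ?gt_eqF// mul1r; lra.
split; first by move=> [w s] Gw; exists w, s, 0; rewrite scale0r mul0r !addr0.
by exists c, 0, 0, 1; rewrite scale1r mul1r !add0r.
Qed.

Lemma hahn_banach (x0 : V) :
  exists2 f : V -> R^o, linear f & (forall x, f x <= p x) /\ f x0 = p x0.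
Proof.
pose L : set (V * R) := [set (t *: x0, t * p x0) | t in setT].
have Lpartial : partial_functional L.
  split; first split.
  - by exists 0 => //; rewrite scale0r mul0r.
  - move=> a _ _ [t _ <-] [t' _ <-]; exists (a * t + t') => //.
    by congr pair => /=; rewrite ?scalerDl ?scalerA// /GRing.scale/=; ring.
  - move=> _ [t _ <-] /=; have [t0|t0] := leP 0 t; first by rewrite pZ.
    have := pD (t *: x0) ((- t) *: x0).
    have nt : 0 <= - t by rewrite oppr_ge0 ltW.
    by rewrite -scalerDl addrN scale0r p0 (pZ _ nt); lra.
(* Uniting with [L] in the predicate, instead of requiring [G] to contain [L], lets the empty chain
   pass: its union is empty, and [L] itself is admissible. *)
have [|A [PA Amax]] := @Zorn_bigcup _ [set G | partial_functional (G `|` L)].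
  move=> C CP Ctot; split; last first.
    move=> z [[G CG Gz]|Lz]; last exact: Lpartial.2.
    by apply: (CP _ CG).2; left.
  split; first by right; exact: Lpartial.1.1.
  move=> a z w.
  move=> [[G CG Gz]|Lz] [[H CH Hw]|Lw]; last by right; exact: Lpartial.1.2.
  - have [GH|HG] := Ctot _ _ CG CH.
      have [||HH|LH] := (CP _ CH).1.2 a z w; [by left; exact: GH|by left|..].
        by left; exists H.
      by right.
    have [||HH|LH] := (CP _ CG).1.2 a z w; [by left|by left; exact: HG|..].
      by left; exists G.
    by right.
  - have [||HH|LH] := (CP _ CG).1.2 a z w; [by left|by right|..].
      by left; exists G.
    by right.
  - have [||HH|LH] := (CP _ CH).1.2 a z w; [by right|by left|..].
      by left; exists H.
    by right.
set G := A `|` L in PA.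
have Gtotal v : exists c, G (v, c).
  have [G' PG' [GG' [c G'c]]] := one_step_extension v PA.
  exists c; apply: contrapT => nGc; apply: (Amax G').
    by split=> [z Az|G'A]; [apply: GG'; left|apply: nGc; left; exact: G'A].
  rewrite /= (_ : G' `|` L = G') //; apply/setUidPl => z Lz.
  by apply: GG'; right.
have [[G0 GZD] Gp] := PA.
(* Single-valuedness follows from domination: [c - d] and [d - c] are both values at 0, hence at
   most [p 0 = 0]. *)
have Gfun v c d : G (v, c) -> G (v, d) -> c = d.
  move=> Gc Gd; have := GZD (-1) _ _ Gc Gd; have := GZD (-1) _ _ Gd Gc.
  rewrite !scaleN1r => /Gp/= + /Gp/=; rewrite addNr p0; lra.
pose f v := sval (cid (Gtotal v)).
have Gf v : G (v, f v) := svalP (cid (Gtotal v)).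
exists f.
  by move=> a x y; apply: (Gfun _ _ _ (Gf _)); exact: (GZD a _ _ (Gf x) (Gf y)).
split=> [x|]; first exact: (Gp _ (Gf x)).
apply: (Gfun _ _ _ (Gf _)); right.
by exists 1 => //; rewrite scale1r mul1r.
Qed.

End HahnBanach.

(** * Finite rank maps into spaces of bounded functions *)

Lemma real_finite_coloring (R : realType) (X : Type) (A : set X) (f : X -> R)
    (M e : R) :
  0 < e -> (forall x, A x -> `|f x| <= M) ->
  exists (T : finType) (c : X -> T),
    forall x y, A x -> A y -> c x = c y -> `|f x - f y| <= e.
Proof.
move=> e0 fM; pose N := Num.truncn ((M + M) / e).
(* The interval from [-M] to [M] is cut into steps of length [e]; the shift by [M] makes the
   quotient nonnegative, as the bounds on [truncn] require. *)
exists 'I_N.+1, (fun x => inord (Num.truncn ((f x + M) / e))) => x y Ax Ay.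
have rng z : A z -> 0 <= (f z + M) / e /\ (Num.truncn ((f z + M) / e) < N.+1)%N.
  move=> /fM; rewrite ler_norml => /andP[lo hi]; split.
    by apply: divr_ge0; [lra|exact: ltW].
  by rewrite ltnS; apply: le_truncn; rewrite ler_pM2r ?invr_gt0//; lra.
have [x0 xN] := rng _ Ax; have [y0 yN] := rng _ Ay.
move=> /(congr1 val); rewrite /= !inordK// => xy.
have /andP[x1 x2] := truncn_itv x0; have /andP[y1 y2] := truncn_itv y0.
rewrite xy in x1 x2.
have xyE : f x - f y = ((f x + M) / e - (f y + M) / e) * e by field; rewrite gt_eqF.
rewrite xyE normrM (gtr0_norm e0) ler_piMl ?(ltW e0)// ler_norml.
by move: x1 x2 y1 y2; rewrite -natr1; lra.
Qed.

Section Scalars.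
Variables (R : realType) (k : scalar_kind).
Local Notation K := (scalar_field R k).

(** In the complex case the real and imaginary parts are coloured separately up to [e / 2], and the
    modulus is at most the sum of their absolute values. *)
Lemma scalar_totally_bounded (X : Type) (A : set X) (f : X -> K^o) (M : K) :
  (forall x, A x -> `|f x| <= M) -> totally_bounded_on A f.
Proof.
case: k f M => /= f M fM e; first by move=> e0; exact: real_finite_coloring fM.
case: e => e e' ; rewrite ltcE/= => /andP[/eqP-> e0].
have e20 : 0 < e / 2 by rewrite divr_gt0.
have ReM x : A x -> `|complex.Re (f x)| <= complex.Re M.
  move=> /fM; case: (f x) => a b.
  rewrite normc_def lecE/= => /andP[_]; apply: le_trans.
  by rewrite -sqrtr_sqr ler_wsqrtr// lerDl sqr_ge0.
have ImM x : A x -> `|complex.Im (f x)| <= complex.Re M.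
  move=> /fM; case: (f x) => a b.
  rewrite normc_def lecE/= => /andP[_]; apply: le_trans.
  by rewrite -sqrtr_sqr ler_wsqrtr// lerDr sqr_ge0.
have [T [c cP]] := real_finite_coloring e20 ReM.
have [T' [d dP]] := real_finite_coloring e20 ImM.
exists (T * T')%type, (fun x => (c x, d x)) => x y Ax Ay [cxy dxy].
have := cP _ _ Ax Ay cxy; have := dP _ _ Ax Ay dxy.
case: (f x) (f y) => a b [a' b'] /= bE aE.
rewrite normc_def lecE/= eqxx/=.
rewrite -[leRHS](gtr0_norm e0) -sqrtr_sqr ler_wsqrtr//.
rewrite (_ : e ^+ 2 = (e / 2 + e / 2) ^+ 2) -?splitr//.
have := lerD aE bE.
rewrite -(real_normK (num_real (a - a'))) -(real_normK (num_real (b - b'))).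
move: (`|a - a'|) (`|b - b'|) (normr_ge0 (a - a')) (normr_ge0 (b - b')) => s t.
by move=> s0 t0 st; nra.
Qed.

Section Linf.
Variable I : Type.

Definition interpolate (s : seq (I * linf K I)) (f : linf K I) : linf K I :=
  \sum_(p <- s) (f p.1 : K) *: p.2.

Lemma interpolate_linear s : linear (interpolate s).
Proof.
move=> a f g; rewrite /interpolate scaler_sumr -big_split/=.
by apply: eq_bigr => p _; rewrite scalerA -scalerDl.
Qed.

Lemma interpolateE s f i :
  interpolate s f i = \sum_(p <- s) (f p.1 : K) * (p.2 i : K).
Proof. by rewrite /interpolate; elim/big_rec2 : _ => // p x y _ <-. Qed.

(** The old vectors are corrected so that the new operator adds to the old one its residual at [i]
    times [w]; whatever was reproduced before stays reproduced. *)
Definition add_node (s : seq (I * linf K I)) i (w : linf K I) :=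
  (i, w) :: map (fun p : I * linf K I =>
    (p.1, p.2 - (p.2 i : K) *: w) : I * linf K I) s.

Lemma interpolate_add_node s i (w f : linf K I) :
  interpolate (add_node s i w) f =
  interpolate s f + (f i - interpolate s f i : K) *: w.
Proof.
rewrite interpolateE /interpolate big_cons big_map /=.
under eq_bigr do rewrite scalerBr scalerA.
by rewrite sumrB -scaler_suml scalerBl addrCA.
Qed.

(* Greedy interpolation: if [g] is the error of the current operator on a new
   vector, one extra node where [g] does not vanish corrects it. This bounds the
   coordinates without the equivalence of norms in finite dimension. *)
Lemma linf_interpolation (b : seq (linf K I)) :
  exists s : seq (I * linf K I), forall f, f \in b -> interpolate s f = f.
Proof.
elim: b => [|h b [s IH]]; first by exists [::].
pose g := h - interpolate s h.
have [g0|g0] := eqVneq g 0.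
  exists s => f; rewrite inE => /orP[/eqP->|/IH//].
  by apply/esym/eqP; rewrite -subr_eq0; exact/eqP.
have [i gi] : exists i, g i != 0.
  apply: contrapT => /forallNP gi0; move/eqP: g0; apply; apply/val_inj/funext => i.
  by apply/eqP/negPn/negP; exact: gi0.
(* The residual of [h] at [i] is [g i], so this scaling makes the correction term exactly [g]. *)
pose w : linf K I := (g i : K)^-1 *: g.
exists (add_node s i w) => f fb.
rewrite interpolate_add_node; move: fb; rewrite inE => /orP[/eqP->|/IH ->].
  by rewrite -linfB -/g scalerA divff// scale1r addrC subrK.
by rewrite subrr scale0r addr0.
Qed.

Lemma linf_span_interpolation (n : nat) (b : 'I_n -> linf K I) :
  exists s : seq (I * linf K I), forall f, linear_span (range b) f ->
    interpolate s f = f.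
Proof.
have [s sP] := linf_interpolation [seq b i | i : 'I_n].
exists s => f; apply: (@linear_span_min _ _ _ [set f | interpolate s f = f]).
  split=> [|a x y /= xE yE]; last by rewrite interpolate_linear xE yE.
  by rewrite /= /interpolate big1// => p _; rewrite scale0r.
by move=> _ [i _ <-]; apply: sP; apply/mapP; exists i; rewrite ?mem_enum.
Qed.

Lemma linf_totally_bounded (X : Type) (A : set X) (f : X -> linf K I) (M : K) :
  finite_dimensional (linear_span (range f)) ->
  (forall x, A x -> `|f x| <= M) -> totally_bounded_on A f.
Proof.
move=> [n [b fb]] fM e e0.
have [s sP] := linf_span_interpolation b.
have fE x : f x = interpolate s (f x).
  by apply/esym/sP; rewrite -fb; apply: sub_linear_span; exists x.
(* If all node coordinates of two values agree up to [d], the values agree up to [d * C]. The later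
   [C + 1] avoids division by zero. *)
pose C := \sum_(p <- s) `|p.2|.
have C0 : 0 < C + 1 by rewrite ltr_wpDl// sumr_ge0.
have [||T [c cP]] := @totally_bounded_ffun K 'I_(size s) X K^o A
    (fun i x => f x (tnth (in_tuple s) i).1) _ (e / (C + 1)).
- move=> i; apply: (@scalar_totally_bounded _ _ _ M) => x Ax.
  by rewrite (le_trans (linf_norm_ge _ _))//; exact: fM.
- by rewrite divr_gt0.
exists T, c => x y Ax Ay /(cP _ _ Ax Ay) {}cP.
rewrite (fE x) (fE y) /interpolate -sumrB.
rewrite (le_trans (ler_norm_sum _ _ _))//.
apply: (@le_trans _ _ (\sum_(p <- s) e / (C + 1) * `|p.2|)).
  rewrite [leLHS]big_tnth [leRHS]big_tnth; apply: ler_sum => i _.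
  by rewrite -scalerBl normrZ ler_wpM2r//; exact: cP.
by rewrite -mulr_sumr -/C -mulrA ger_pMr// ler_pdivrMl// mulr1 lerDl.
Qed.

End Linf.
End Scalars.

(** * The canonical embedding is bounded below *)

Lemma linear_oppr (K : numFieldType) (V W : lmodType K) (T : V -> W) :
  linear T -> forall x, T (- x) = - T x.
Proof.
move=> Tlin x; have TN : T (-1 *: x) = -1 *: T x by exact: (scalable_linear Tlin).
by rewrite -scaleN1r TN scaleN1r.
Qed.

Lemma linear_subr (K : numFieldType) (V W : lmodType K) (T : V -> W) :
  linear T -> forall x y, T (x - y) = T x - T y.
Proof.
by move=> Tlin x y; rewrite -[x in LHS]scale1r Tlin scale1r linear_oppr.
Qed.

Lemma unit_ball_neq0 (K : numFieldType) (V : normedModType K) :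
  unit_ball V !=set0.
Proof. by exists 0; rewrite /unit_ball/= normr0. Qed.

Lemma contraction_continuous (K : numFieldType) (V W : normedModType K)
    (T : V -> W) :
  linear T -> (forall x, `|T x| <= `|x|) -> continuous T.
Proof.
move=> Tlin T1 x; apply/cvgrPdist_lt => e e0.
near=> y; rewrite -linear_subr// (le_lt_trans (T1 _))//; near: y.
Unshelve. all: by end_near. Qed.

(** Domination by the norm, used also at [- x], bounds the absolute value. The constant 2 is shared
    with the complex case. *)
Lemma real_norming_functional (R : realType) (F : normedModType R) (y : F) :
  exists2 phi : F -> R^o, linear phi &
    (forall x, `|phi x| <= `|x|) /\ `|y| <= 2 * `|phi y|.
Proof.
have [||f flin [fle fy]] := @hahn_banach R F (fun x => `|x|) _ _ y.
- exact: ler_normD.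
- by move=> a x a0; rewrite normrZ ger0_norm.
exists f => //; split=> [x|]; last by rewrite fy normr_id ler_peMl// ler1n.
rewrite ler_norml fle andbT lerNl -[leRHS]normrN.
rewrite -(linear_oppr flin).
exact: fle.
Qed.

Section Realification.
Variables (R : realType) (F : lmodType R[i]).

(** A separate name for the carrier keeps the real scalar multiplication apart from the complex
    one. *)
Definition realification : Type := F.
HB.instance Definition _ := GRing.Zmodule.on realification.

Let scale (a : R) (x : realification) : realification := (a%:C%C : R[i]) *: (x : F).
Let scaleA a b v : scale a (scale b v) = scale (a * b) v.
Proof. by rewrite /scale scalerA -rmorphM. Qed.
Let scale1 : left_id 1 scale.
Proof. by move=> v; rewrite /scale scale1r. Qed.
Let scaleDr : right_distributive scale +%R.
Proof. by move=> a v w; rewrite /scale scalerDr. Qed.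
Let scaleDl v : {morph scale^~ v : a b / a + b}.
Proof. by move=> a b; rewrite /scale rmorphD scalerDl. Qed.

HB.instance Definition _ := GRing.Zmodule_isLmodule.Build R realification
  scaleA scale1 scaleDr scaleDl.

Lemma realificationZ (a : R) (x : F) :
  a *: (x : realification) = (a%:C%C : R[i]) *: x.
Proof. by []. Qed.

End Realification.

(* The norming constant 2 saves rotating the real functional [u]: its
   complexification [u x - i u (i x)] is crudely bounded by [2 |x|]. *)
Lemma complex_norming_functional (R : realType) (F : normedModType R[i]) (y : F) :
  exists2 phi : F -> R[i]^o, linear phi &
    (forall x, `|phi x| <= `|x|) /\ `|y| <= 2 * `|phi y|.
Proof.
pose p (x : realification F) : R := complex.Re `|x : F|.
have normE (x : F) : `|x| = (p x)%:C%C.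
  have := normr_ge0 x; rewrite /p; case: `|x| => a b.
  by rewrite lecE/= => /andP[/eqP->].
have [||u ulin [ule uy]] := @hahn_banach R (realification F) p _ _ y.
- by move=> x z; rewrite -lecR rmorphD/= -!normE ler_normD.
- move=> a x a0; apply: (@complexI R).
  by rewrite rmorphM/= -!normE realificationZ normrZ ger0_norm// lecR.
have uN x : - u x = u (- x).
  by rewrite (linear_oppr ulin).
have uabs x : `|u x| <= p x.
  rewrite ler_norml ule andbT lerNl uN (le_trans (ule _))//.
  by rewrite -lecR -!normE normrN.
have piE (x : F) : p ('i%C *: x) = p x.
  have normi : `|'i%C : R[i]| = 1 by rewrite normc_def/= expr0n/= expr1n add0r sqrtr1.
  by apply: (@complexI R); rewrite -!normE normrZ normi mul1r.
(* After halving, both parts are at most [p x / 2] in absolute value, so the modulus is at most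
   [p x]; the real part at [y] is [p y / 2], whence the constant 2. *)
pose phi (x : F) : R[i]^o := (u x / 2 +i* (- u ('i%C *: x) / 2))%C.
exists phi.
  have split_scale (a b : R) (x : F) :
      (a +i* b)%C *: x = (a%:C%C : R[i]) *: x + (b%:C%C : R[i]) *: ('i%C *: x).
    by rewrite scalerA -scalerDl; congr (_ *: _); simpc.
  move=> [a b] x z; rewrite /phi.
  have uE w : u ((a +i* b)%C *: x + w) = a * u x + b * u ('i%C *: x) + u w.
    have -> : (a +i* b)%C *: x + w =
        a *: (x : realification F) + (b *: ('i%C *: x : realification F) + w).
      by rewrite split_scale -addrA.
    by rewrite !ulin addrA.
  have uiE w : u ('i%C *: ((a +i* b)%C *: x + w)) =
      a * u ('i%C *: x) - b * u x + u ('i%C *: w).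
    have -> : 'i%C *: ((a +i* b)%C *: x + w) =
      a *: ('i%C *: x : realification F) + ((- b) *: (x : realification F) + 'i%C *: w).
      rewrite scalerDr scalerA (_ : 'i%C * (a +i* b)%C = (- b +i* a)%C); last by simpc.
      by rewrite split_scale -addrA addrCA.
    by rewrite !ulin addrA /GRing.scale/= mulNr.
  rewrite uE uiE /GRing.scale/=; apply/eqP; rewrite eq_complex/=.
  by apply/andP; split; apply/eqP; field.
split=> [x|].
  rewrite normE normc_def lecR/=.
  have p0 : 0 <= p x := le_trans (normr_ge0 _) (uabs x).
  rewrite -[leRHS](ger0_norm p0) -sqrtr_sqr ler_wsqrtr//.
  have := uabs x; have := uabs ('i%C *: x); rewrite piE !ler_norml.
  by move=> /andP[a1 a2] /andP[b1 b2]; nra.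
rewrite normE normc_def -(rmorph_nat (real_complex R)) -rmorphM/= lecR -uy.
have : `|u y / 2| <= Num.sqrt ((u y / 2) ^+ 2 + (- u ('i%C *: y) / 2) ^+ 2).
  by rewrite -sqrtr_sqr ler_wsqrtr// lerDl sqr_ge0.
by move=> /(le_trans (ler_norm _)); lra.
Qed.

Section Main.
Variables (R : realType) (k : scalar_kind).
Local Notation K := (scalar_field R k).

Lemma dual_ball_norming (F : normedModType K) (y : F) :
  exists phi : dual_ball F, `|y| <= 2 * `|sval phi y|.
Proof.
have [phi lphi [phi1 phiy]] : exists2 phi : F -> K^o, linear phi &
    (forall x, `|phi x| <= `|x|) /\ `|y| <= 2 * `|phi y|.
  case: k F y => /= F y; first exact: real_norming_functional.
  exact: complex_norming_functional.
suff phiP : [/\ linear phi, continuous phi & sup_norm (unit_ball F) phi <= 1].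
  by exists (exist _ phi phiP).
split => //; first exact: contraction_continuous.
have [||_] := @sup_normP R k F K^o (unit_ball F) phi.
- exact: unit_ball_neq0.
- by exists 1 => x; exact: le_trans.
by apply=> x; exact: le_trans.
Qed.

Lemma canonical_map_linear (F : normedModType K) : linear (@canonical_map R k F).
Proof.
move=> a x y; apply/val_inj/funext => phi /=.
by case: phi => phi [lphi ? ?] /=; rewrite lphi.
Qed.

Lemma canonical_map_le (F : normedModType K) (y : F) : `|canonical_map y| <= `|y|.
Proof. by apply: linf_norm_le => // phi; exact: dual_ball_le. Qed.

Lemma canonical_map_ge (F : normedModType K) (y : F) :
  `|y| <= 2 * `|canonical_map y|.
Proof.
have [phi /le_trans] := dual_ball_norming y; apply; rewrite ler_pM2l//.
exact: (linf_norm_ge (canonical_map y) phi).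
Qed.

End Main.

(** * The injective hull *)

Section Sampling.
Variables (R : realType) (k : scalar_kind).
Local Notation K := (scalar_field R k).
Variables (I : Type) (T : finType) (d : I -> T) (r : T -> I).

Lemma sampling_bounded (f : linf K I) : (fun i => f (r (d i))) \in bounded_pred I.
Proof. by have [M fM] := linf_bounded f; apply/bounded_predP; exists M. Qed.

Definition sampling (f : linf K I) : linf K I := Linf (sampling_bounded f).

Lemma sampling_linear : linear sampling.
Proof. by move=> a f g; apply/val_inj/funext. Qed.

Lemma sampling_le f : `|sampling f| <= `|f|.
Proof. by apply: linf_norm_le => // i; exact: (linf_norm_ge f). Qed.

Lemma indicator_bounded t : (fun i => (d i == t)%:R : K^o) \in bounded_pred I.
Proof.
by apply/bounded_predP; exists 1 => i; case: eqP; rewrite /= ?normr1 ?normr0.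
Qed.

(** A sampled function is constant on colour classes, so it is a combination of their indicators. *)
Lemma sampling_range f :
  linear_span (range (fun j : 'I_#|T| => Linf (indicator_bounded (enum_val j))))
    (sampling f).
Proof.
rewrite linear_span_range; exists (\row_j (f (r (enum_val j)) : K)) => //.
have linf_sum (J : Type) (s : seq J) (F : J -> linf K I) i :
    (\sum_(j <- s) F j) i = \sum_(j <- s) (F j i : K).
  by elim/big_rec2 : _ => // j x y _ <-.
apply/val_inj/funext => i /=; rewrite linf_sum.
under eq_bigr do rewrite mxE.
transitivity (\sum_(j < #|T|) (f (r (enum_val j)) : K) * ((d i == enum_val j)%:R : K)).
  by [].
rewrite (bigD1 (enum_rank (d i)))//= big1 ?addr0 => [|j jd].
  by rewrite enum_rankK eqxx mulr1.
rewrite (_ : _ == _ = false) ?mulr0//.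
by apply: contra_neqF jd => /eqP ->; rewrite enum_valK.
Qed.

End Sampling.

(** * The two inclusions *)

Section Main.
Variables (R : realType) (k : scalar_kind).
Local Notation K := (scalar_field R k).
Variables (E F : completeNormedModType K) (m : nat) (P : E -> F).

(** Boundedness on the unit ball makes [sup_norm] a genuine supremum rather than the default value
    0. *)
Lemma sup_norm_polynomial (V : completeNormedModType K) (Q Q' : E -> V) :
  cont_polynomial m Q -> cont_polynomial m Q' ->
  forall x, unit_ball E x -> `|Q x - Q' x| <= sup_norm (unit_ball E) (Q \- Q').
Proof.
move=> /cont_polynomial_bounded/(_ 1)[M QM] /cont_polynomial_bounded/(_ 1)[M' QM'].
have [||+ _] := @sup_normP R k E V (unit_ball E) (Q \- Q');
  [exact: unit_ball_neq0| |exact].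
exists (M + M') => x x1; rewrite (le_trans (ler_normB _ _))// lerD//.
  exact: QM.
exact: QM'.
Qed.

Lemma hull_approximable_compact :
  injective_hull approximable E F m P -> compact_polynomial E F m P.
Proof.
move=> [cP [cIP aIP]]; split=> // B bB; apply: totally_bounded_precompact => e e0.
have tIP : totally_bounded_on (unit_ball E) (@canonical_map R k F \o P).
  apply: totally_bounded_on_approx => d d0; have [Q [cQ fQ] Qd] := aIP _ d0.
  exists Q => [|x x1]; last first.
    by rewrite (le_trans (sup_norm_polynomial cIP cQ x1))// ltW.
  have [M QM] := cont_polynomial_bounded cQ 1.
  exact: linf_totally_bounded fQ QM.
have [t t0 Bt] : exists2 t, 0 < t & forall x, B x -> `|x| <= t.
  by have [t t0 Bt] := pinfty_ex_gt0 bB; exists t.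
have t'0 : 0 < t ^+ m by rewrite exprn_gt0.
(* The factor [t ^+ m] pays for rescaling [B] into the unit ball, the factor 2 for inverting the
   canonical map. *)
have [|T [c cP']] := tIP (e / (2 * t ^+ m)).
  by rewrite divr_gt0// mulr_gt0.
exists T, (fun x => c (t^-1 *: x)) => x y Bx By cxy.
have scaled z : P z = t ^+ m *: P (t^-1 *: z).
  by rewrite -(homogeneous_polynomialZ cP.1) scalerKV ?gt_eqF.
have in_ball z : B z -> unit_ball E (t^-1 *: z).
  move=> Bz; rewrite /unit_ball/= normrZ normfV gtr0_norm// ler_pdivrMl// mulr1.
  exact: Bt.
have := cP' _ _ (in_ball _ Bx) (in_ball _ By) cxy.
rewrite /= -(linear_subr (@canonical_map_linear R k F)) => Ixy.
rewrite (scaled x) (scaled y) -scalerBr normrZ gtr0_norm//.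
rewrite -ler_pdivlMl// (le_trans (canonical_map_ge _))//.
rewrite -ler_pdivlMl// (le_trans Ixy)// le_eqVlt; apply/orP; left; apply/eqP.
by rewrite invfM mulrC -mulrA.
Qed.

Lemma compact_hull_approximable :
  compact_polynomial E F m P -> injective_hull approximable E F m P.
Proof.
move=> [cP kP]; split => //.
have cIP : cont_polynomial m (@canonical_map R k F \o P).
  apply: cont_polynomial_comp => //; first exact: canonical_map_linear.
  apply: contraction_continuous; first exact: canonical_map_linear.
  exact: canonical_map_le.
split=> // e e0; have e20 : 0 < e / 2 by rewrite divr_gt0.
(* Three errors of this size add up to [e / 2]; the pointwise bound passes to the supremum only
   non-strictly, and [e / 2 < e] restores strictness. *)
have e30 : 0 < e / 2 / 3 by rewrite divr_gt0.
have bball : bounded_set (unit_ball E).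
  by exists 1; split; [exact: real1|move=> M M1 x /= /le_trans; apply; exact: ltW].
have [T [c cA]] := precompact_totally_bounded (kP _ bball) e30.
have [x0 x01] := unit_ball_neq0 E.
(* A colour not attained on the unit ball gets the default [x0], for which the condition is
   vacuous. *)
have net t : exists x, unit_ball E x /\
    forall x', unit_ball E x' -> c x' = t -> `|P x' - P x| <= e / 2 / 3.
  have [[x [x1 xt]]|no] := pselect (exists x, unit_ball E x /\ c x = t).
    by exists x; split=> // x' x'1 x't; apply: cA => //; rewrite xt.
  by exists x0; split=> // x' x'1 x't; case: no; exists x'.
pose y t := P (sval (cid (net t))).
have yP x : unit_ball E x -> `|P x - y (c x)| <= e / 2 / 3.
  by move=> x1; have [_] := svalP (cid (net (c x))); exact.
have [||T' [d dP]] := @totally_bounded_ffun K T (dual_ball F) K^o setT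
    (fun t phi => sval phi (y t)) _ (e / 2 / 3) => //.
  move=> t; apply: (@scalar_totally_bounded _ _ _ _ _ `|y t|) => phi _.
  exact: dual_ball_le.
(* This only supplies a point of the dual ball, the default representative of an unattained
   colour. *)
have [phi0 _] := @dual_ball_norming R k F 0.
have rep t' : exists psi : dual_ball F, forall phi, d phi = t' -> d psi = t'.
  have [[psi psit]|no] := pselect (exists psi, d psi = t'); first by exists psi.
  by exists phi0 => phi phit; case: no; exists phi.
pose r t' := sval (cid (rep t')).
have rP phi : d (r (d phi)) = d phi by exact: (svalP (cid (rep (d phi)))) erefl.
pose S := sampling (R := R) (k := k) d r.
have cQ : cont_polynomial m (S \o (@canonical_map R k F \o P)).
  apply: cont_polynomial_comp => //; first exact: sampling_linear.
  apply: contraction_continuous; first exact: sampling_linear.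
  exact: sampling_le.
exists (S \o (@canonical_map R k F \o P)).
  split=> //; apply: subspace_finite_dimensional (linear_span_subspace _) _.
  apply: linear_span_min; first exact: linear_span_subspace.
  by move=> _ [x _ <-]; exact: sampling_range.
apply: (@le_lt_trans _ _ (e / 2)); last first.
  by rewrite ltr_pdivrMr// ltr_pMr// ltr1n.
have close x : unit_ball E x ->
    `|canonical_map (P x) - S (canonical_map (P x))| <= e / 2.
  move=> x1; apply: linf_norm_le => [|phi]; first exact: ltW.
  rewrite linfB /=; set psi := r (d phi).
  have evB (chi : dual_ball F) : `|sval chi (P x) - sval chi (y (c x))| <= e / 2 / 3.
    have -> : sval chi (P x) - sval chi (y (c x)) = sval chi (P x - y (c x)).
      by case: chi => chi [lchi ? ?] /=; rewrite linear_subr.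
    by rewrite (le_trans (dual_ball_le _ _))//; exact: yP.
  rewrite (third_split (e / 2)).
  (* The outer terms are small because [P x] is near [y (c x)] and functionals of the dual ball are
     contractions; the middle one because [phi] and [psi] have the same colour. *)
  rewrite (le_trans (ler_dist3 (sval phi (P x) : K^o) (sval phi (y (c x)))
    (sval psi (y (c x))) _))//.
  apply: lerD; [apply: lerD|]; [exact: evB| |by rewrite distrC; exact: evB].
  by apply: dP => //; rewrite rP.
have [||_] := @sup_normP R k E (linf K (dual_ball F)) (unit_ball E)
   ((@canonical_map R k F \o P) \- (S \o (@canonical_map R k F \o P))).
- exact: unit_ball_neq0.
- by exists (e / 2) => x; exact: close.
by apply => x; exact: close.
Qed.

End Main.

Theorem corollary3p7 (R : realType) (k : scalar_kind)
    (E F : completeNormedModType (scalar_field R k)) (m : nat) :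
  injective_hull approximable E F m = compact_polynomial E F m.
Proof.
apply/seteqP; split=> P.
  exact: hull_approximable_compact.
exact: compact_hull_approximable.
Qed.
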